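(* Let $n\ge2$ and $1\le k\le n-1$ be integers with $\gcd(n,k)>1$. Then the equal point is not a strict local minimum of $S_{n,k}$ modulo scaling. More precisely, there are nonconstant positive vectors $x$, arbitrarily close to the equal point, such that \[ S_{n,k}(x)=\frac nk . \] Consequently, for integers $n\ge 2$ and $1\le k\le n-1$, $\gcd(n,k)=1$ is a necessary condition for strict local quadratic stability of the equal point.
   Context: Indices are modulo $n$. For $x_i>0$, $S_{n,k}(x)=\sum_{i=1}^n\frac{x_i}{x_{i+1}+\cdots+x_{i+k}}$, which is homogeneous of degree $0$. The equal point is $(1,\dots,1)$ (considered up to common scaling), where $S_{n,k}=n/k$. ''Strict local minimum modulo scaling'' means: there is a neighbourhood $U$ of $(1,\dots,1)$ in the positive orthant such that $S_{n,k}(x)>n/k$ for every nonconstant $x\in U$. ''Strict local quadratic stability'' means: there are $c>0$ and a neighbourhood of $(1,\dots,1)$ on which $S_{n,k}(x)-\frac nk\ge c\sum_{i=1}^n(\log x_i-\overline{\log x})^2$, where $\overline{\log x}=\frac1n\sum_{i=1}^n\log x_i$. *)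

(* Defs.v *)
From HB Require Import structures.
From mathcomp Require Import all_boot all_order all_algebra.
From mathcomp Require Import all_classical all_reals all_analysis.
Set Implicit Arguments.
Unset Strict Implicit.
Unset Printing Implicit Defensive.
Import Order.TTheory GRing.Theory Num.Theory.
Import numFieldNormedType.Exports.
Local Open Scope classical_set_scope.
Local Open Scope ring_scope.

(* Indices 1, ..., n modulo n are encoded as 'I_n, with the cyclic successor
   ordS; the index i + j modulo n is iter j (@ordS n) i. *)
Lemma val_iter_ordS (n j : nat) (i : 'I_n) :
  iter j (@ordS n) i = ((i + j) %% n)%N :> nat.
Proof.
elim: j => [|j IHj] /=; first by rewrite addn0 modn_small.
by rewrite IHj -addn1 modnDml addn1 addnS.
Qed.

Definition cyclic_sum (R : realType) (n k : nat) (x : 'rV[R]_n) : R :=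
  \sum_(i < n) x 0 i / \sum_(1 <= j < k.+1) x 0 (iter j (@ordS n) i).

Definition equal_point (R : realType) (n : nat) : 'rV[R]_n := const_mx 1.

Definition positive_vector (R : realType) (n : nat) (x : 'rV[R]_n) : Prop :=
  forall i, 0 < x 0 i.

Definition nonconstant (R : realType) (n : nat) (x : 'rV[R]_n) : Prop :=
  ~ exists c : R, x = const_mx c.

Definition strict_local_min_mod_scaling (R : realType) (n k : nat) : Prop :=
  \forall x \near nbhs (equal_point R n),
    positive_vector x -> nonconstant x -> n%:R / k%:R < cyclic_sum k x.

Definition mean_ln (R : realType) (n : nat) (x : 'rV[R]_n) : R :=
  n%:R^-1 * \sum_(i < n) ln (x 0 i).

Definition strict_local_quadratic_stability
    (R : realType) (n k : nat) : Prop :=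
  exists2 c : R, 0 < c &
    \forall x \near nbhs (equal_point R n), positive_vector x ->
      c * \sum_(i < n) (ln (x 0 i) - mean_ln x) ^+ 2
        <= cyclic_sum k x - n%:R / k%:R.

(* Main.v *)
(* Put d = gcd(n, k) > 1. A vector whose entries only depend on the index modulo
   d and average to 1 over a period has all its k-window sums equal to k, since
   d divides k, so that the cyclic sum is (sum of the entries) / k = n / k. Such
   vectors exist arbitrarily close to (1, ..., 1); ours are 1 + t v, with v a
   coboundary so that all the sums telescope. *)
Require Import Defs.
From HB Require Import structures.
From mathcomp Require Import all_boot all_order all_algebra.
From mathcomp Require Import all_classical all_reals all_analysis.
Set Implicit Arguments.
Unset Strict Implicit.
Unset Printing Implicit Defensive.
Import Order.TTheory GRing.Theory Num.Theory.
Import numFieldNormedType.Exports.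
Local Open Scope classical_set_scope.
Local Open Scope ring_scope.

(** The coboundary of the indicator of the multiples of [d]. For [d > 1] it is 1 at the residue 0,
    -1 at the residue -1 and 0 elsewhere. *)
Definition periodic_dir (R : realType) (d i : nat) : R :=
  (d %| i)%:R - (d %| i.+1)%:R.

(** Makes the wrap-around invisible: a cyclic window can be summed over consecutive integers. *)
Lemma periodic_dir_modn (R : realType) (n d i : nat) :
  (d %| n)%N -> periodic_dir R d (i %% n) = periodic_dir R d i.
Proof.
move=> dn; have E m : (d %| m %% n)%N = (d %| m)%N.
  by rewrite /dvdn modn_dvdm.
rewrite /periodic_dir E; congr (_ - (nat_of_bool _)%:R).
by rewrite -[in LHS]E -addn1 modnDml addn1 E.
Qed.

(** The sum telescopes to a difference of indicators at [m] and [m + k], which are congruent modulo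
    [d]. *)
Lemma sum_periodic_dir (R : realType) (d m k : nat) :
  (d %| k)%N -> \sum_(m <= i < m + k) periodic_dir R d i = 0.
Proof.
move=> dk; rewrite -[LHS]opprK -sumrN; under eq_bigr do rewrite opprB.
rewrite (telescope_sumr (fun i => (d %| i)%:R)) ?leq_addr//.
by rewrite dvdn_addl// subrr oppr0.
Qed.

Lemma normr_periodic_dir (R : realType) (d i : nat) : `|periodic_dir R d i| <= 1.
Proof.
by rewrite /periodic_dir; do 2 case: (_ %| _)%N;
  rewrite /= ?subrr ?subr0 ?sub0r ?normrN ?normr0 ?normr1.
Qed.

Definition periodic_perturbation (R : realType) (n d : nat) (t : R) : 'rV[R]_n :=
  \row_i (1 + t * periodic_dir R d i).

Lemma cyclic_sum_periodic_perturbation (R : realType) (n k d : nat) (t : R) :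
  (d %| n)%N -> (d %| k)%N ->
  cyclic_sum k (periodic_perturbation n d t) = n%:R / k%:R.
Proof.
move=> dn dk; rewrite /cyclic_sum.
have window (i : 'I_n) : \sum_(1 <= j < k.+1)
    periodic_perturbation n d t 0 (iter j (@ordS n) i) = k%:R.
  have telescope : \sum_(1 <= j < k.+1) periodic_dir R d (i + j) = 0.
    (* The window of [i] excludes [i] itself, so it starts at [i.+1]. *)
    rewrite -[RHS](sum_periodic_dir R i.+1 dk) -(add1n i) big_addn.
    rewrite addnAC addnK add1n.
    by apply: eq_bigr => j _; rewrite addnC.
  under eq_bigr do rewrite mxE val_iter_ordS periodic_dir_modn//.
  rewrite big_split/= sumr_const_nat subn1/= -mulr_sumr.
  by rewrite telescope mulr0 addr0.
under eq_bigr do rewrite window.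
rewrite -mulr_suml; congr (_ / _).
under eq_bigr do rewrite mxE.
rewrite big_split/= sumr_const card_ord -mulr_sumr.
(* The numerators run over a full turn: a window of length [n] starting at 0, whence the use of
   [dn]. *)
rewrite -(big_mkord xpredT (periodic_dir R d)).
by rewrite -[n in X in _ * X]add0n sum_periodic_dir// mulr0 addr0.
Qed.

(** The entries at 0 and [d.-1] are [1 + t] and [1 - t]. *)
Lemma nonconstant_periodic_perturbation (R : realType) (n d : nat) (t : R) :
  (1 < d)%N -> (d <= n)%N -> t != 0 -> nonconstant (periodic_perturbation n d t).
Proof.
move=> d1 dn t0 [c /rowP xc].
have d0 : (0 < d)%N by exact: ltnW.
have lt0 : (0 < n)%N by exact: leq_trans dn.
have ltd : (d.-1 < n)%N by rewrite prednK.
have := xc (Ordinal lt0); rewrite !mxE/= /periodic_dir dvdn0 dvdn1 gtn_eqF// subr0.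
have := xc (Ordinal ltd); rewrite !mxE/= /periodic_dir prednK// dvdnn.
rewrite gtnNdvd ?prednK//; last by rewrite -subn1 subn_gt0.
rewrite sub0r mulr1 mulrN1 => <- /addrI /eqP.
by rewrite -subr_eq0 opprK -mulr2n mulrn_eq0 (negPf t0).
Qed.

Lemma cyclic_sum_eq_near_equal_point (R : realType) (n k : nat)
    (U : set 'rV[R]_n) :
  (0 < n)%N -> (1 < gcdn n k)%N -> nbhs (equal_point R n) U ->
  exists x : 'rV[R]_n, [/\ U x, positive_vector x, nonconstant x
    & cyclic_sum k x = n%:R / k%:R].
Proof.
move=> n0 d1 /nbhs_ballP[e /= e0 eU].
(* [t < e] keeps the vector in the ball, and [t < 1] keeps its entries positive. *)
pose t : R := Num.min e 1 / 2.
have m0 : 0 < Num.min e 1 by rewrite lt_min e0 ltr01.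
have t0 : 0 < t by rewrite divr_gt0.
have /andP[te t1] : (t < e) && (t < 1).
  by rewrite -lt_min /t ltr_pdivrMr// ltr_pMr// ltr1n.
have tv i : `|t * periodic_dir R (gcdn n k) i| <= t.
  by rewrite normrM (gtr0_norm t0) ler_piMr ?normr_periodic_dir// ltW.
exists (periodic_perturbation n (gcdn n k) t); split.
- apply: eU; split=> // i j; rewrite !mxE /ball/= opprD addNKr normrN.
  exact: le_lt_trans te.
- move=> i; rewrite mxE -ltrBlDl sub0r.
  by have := le_lt_trans (tv i) t1; rewrite ltr_norml => /andP[].
- apply: nonconstant_periodic_perturbation => //; last by rewrite gt_eqF.
  exact: dvdn_leq (dvdn_gcdl _ _).
- exact: cyclic_sum_periodic_perturbation (dvdn_gcdl _ _) (dvdn_gcdr _ _).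
Qed.

(** If the sum vanished, every [ln (x 0 i)] would equal the mean, and [x] would be constant. *)
Lemma sum_sqr_ln_gt0 (R : realType) (n : nat) (x : 'rV[R]_n) :
  positive_vector x -> nonconstant x ->
  0 < \sum_(i < n) (ln (x 0 i) - mean_ln x) ^+ 2.
Proof.
move=> x0 xnc; rewrite lt_neqAle sumr_ge0 ?andbT; last by move=> *; exact: sqr_ge0.
apply/eqP => /esym /eqP; rewrite psumr_eq0; last by move=> *; exact: sqr_ge0.
move=> /allP all0; apply: xnc; exists (expR (mean_ln x)); apply/rowP => i.
have := all0 i (mem_index_enum i).
by rewrite sqrf_eq0 subr_eq0 mxE => /eqP <-; rewrite lnK// posrE.
Qed.

Theorem corollary5p2 (R : realType) :
  (forall n k : nat, (2 <= n)%N -> (1 <= k <= n - 1)%N -> (1 < gcdn n k)%N ->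
     ~ strict_local_min_mod_scaling R n k
     /\ (forall U : set 'rV[R]_n, nbhs (equal_point R n) U ->
           exists x : 'rV[R]_n,
             [/\ U x, positive_vector x, nonconstant x
               & cyclic_sum k x = n%:R / k%:R]))
  /\ (forall n k : nat, (2 <= n)%N -> (1 <= k <= n - 1)%N ->
        strict_local_quadratic_stability R n k -> gcdn n k = 1%N).
Proof.
split=> [n k n2 _ d1|n k n2 _ [c c0 stab]].
  split=> [smin|U]; last exact: cyclic_sum_eq_near_equal_point (ltnW n2) d1.
  have [x [xU x0 xnc xE]] :=
    cyclic_sum_eq_near_equal_point (ltnW n2) d1 smin.
  by have := xU x0 xnc; rewrite xE ltxx.
apply/eqP; rewrite eqn_leq gcdn_gt0 (ltnW n2) andbT leqNgt; apply/negP => d1.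
(* Inside the neighbourhood of stability, this [x] has zero excess, whereas the quadratic lower
   bound is positive. *)
have [x [xU x0 xnc xE]] :=
  cyclic_sum_eq_near_equal_point (ltnW n2) d1 stab.
by have := xU x0; rewrite xE subrr leNgt mulr_gt0// sum_sqr_ln_gt0.
Qed.
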